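(* Let $d\ge1$ and $0\le j\le d$. Then \[\sum_{n\ge0}\left|nC_j^d\cap\mathbb{Z}^d\right|t^n=\frac{A_{j+1}(d+1,t)}{(1-t)^{d+1}}.\] In particular, the $h^\ast$-polynomial $A_{j+1}(d+1,t)$ of $C_j^d$ is real-rooted and its coefficients form a unimodal sequence.
   Context: For $0\le j\le d$ the half-open unit cube is $C_j^d=[0,1]^d\setminus\{x\in\mathbb{R}^d: x_i=1\text{ for some }i\in\{d+1-j,\dots,d\}\}$ (the cube with the $j$ facets $x_d=1,\dots,x_{d+1-j}=1$ removed), and for $n\ge0$, $nC_j^d=[0,n]^d\setminus\{x:x_i=n\text{ for some }i\ge d+1-j\}$ (so $0\cdot C_j^d=\emptyset$ if $j\ge1$). For $\sigma\in S_m$, $\operatorname{des}(\sigma)=|\{i\in[m-1]:\sigma_i>\sigma_{i+1}\}|$, and $A_j(m,t)=\sum_{\sigma\in S_m,\ \sigma_m=m+1-j}t^{\operatorname{des}(\sigma)}$ for $1\le j\le m$. *)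

(* Defs.v *)
From HB Require Import structures.
From mathcomp Require Import all_boot all_order all_algebra all_fingroup finmap.
From mathcomp Require Import complex.
From mathcomp Require Import boolp classical_sets functions cardinality reals.

Set Implicit Arguments.
Unset Strict Implicit.
Unset Printing Implicit Defensive.

Import Order.TTheory GRing.Theory Num.Theory.
Local Open Scope ring_scope.
Local Open Scope classical_set_scope.

(* Coordinates are numbered from 0: the index i : 'I_d stands for x_(i+1). *)
Definition half_open_cube (R : realType) (d j n : nat) : set 'rV[R]_d :=
  [set x : 'rV[R]_d | forall i, 0 <= x 0 i <= n%:R] `\`
  [set x : 'rV[R]_d | exists i : 'I_d, (d + 1 - j <= i.+1)%N /\ x 0 i = n%:R].

Definition integer_lattice (R : realType) (d : nat) : set 'rV[R]_d :=
  [set x : 'rV[R]_d | forall i, x 0 i \is a Num.int].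

Definition lattice_points (R : realType) (d j n : nat) : set 'rV[R]_d :=
  @half_open_cube R d j n `&` @integer_lattice R d.

(* [fset_set] is only meaningful on finite sets; see [finite_lattice_points]. *)
Definition lattice_count (R : realType) (d j n : nat) : nat :=
  #|` fset_set (@lattice_points R d j n)|.

Lemma finite_lattice_points (R : realType) (d j n : nat) :
  finite_set (@lattice_points R d j n).
Proof.
pose g (f : {ffun 'I_d -> 'I_n.+1}) : 'rV[R]_d := \row_i (f i)%:R.
apply: (@sub_finite_set _ _ (g @` setT)); last exact/finite_image/finite_finset.
move=> x [[xcube _] xint]; exists [ffun i => inord (Num.truncn (x 0 i))] => //.
apply/rowP => i; rewrite mxE ffunE.
have /andP[x0 xn] := xcube i.
have xnat : x 0 i \is a Num.nat by rewrite natrEint xint x0.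
rewrite inordK; first by rewrite truncnK.
by rewrite ltnS -(ler_nat R) truncnK.
Qed.

(* A formal power series is given by its sequence of coefficients. *)
Definition fps (R : Type) := nat -> R.

Definition fps_of_poly (R : nzRingType) (p : {poly R}) : fps R :=
  fun n => p`_n.

Definition fps_mul (R : nzRingType) (f g : fps R) : fps R :=
  fun n => \sum_(i < n.+1) f i * g (n - i)%N.

Fixpoint fps_inv_seq (R : unitRingType) (f : fps R) (n : nat) : seq R :=
  if n is m.+1 then
    let s := fps_inv_seq f m in
    rcons s ((f 0%N)^-1 * ((m == 0)%N%:R - \sum_(i < m) f (m - i)%N * s`_i))
  else [::].

(* The inverse of a series whose constant coefficient is a unit. *)
Definition fps_inv (R : unitRingType) (f : fps R) : fps R :=
  fun n => (fps_inv_seq f n.+1)`_n.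

Definition fps_div (R : unitRingType) (f g : fps R) : fps R :=
  fps_mul f (fps_inv g).

Lemma size_fps_inv_seq (R : unitRingType) (f : fps R) (n : nat) :
  size (fps_inv_seq f n) = n.
Proof. by elim: n => //= n IHn; rewrite size_rcons IHn. Qed.

Lemma nth_fps_inv_seq (R : unitRingType) (f : fps R) (n i : nat) :
  (i < n)%N -> (fps_inv_seq f n)`_i = fps_inv f i.
Proof.
elim: n => // n IHn; rewrite ltnS leq_eqVlt => /predU1P[-> //|ltin].
by rewrite [fps_inv_seq _ _]/= nth_rcons size_fps_inv_seq ltin IHn.
Qed.

Lemma fps_invE (R : unitRingType) (f : fps R) (n : nat) :
  fps_inv f n =
  (f 0%N)^-1 * ((n == 0)%N%:R - \sum_(i < n) f (n - i)%N * fps_inv f i).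
Proof.
rewrite {1}/fps_inv /= nth_rcons size_fps_inv_seq ltnn eqxx.
by congr (_ * (_ - _)); apply: eq_bigr => i _; rewrite nth_fps_inv_seq.
Qed.

Lemma fps_mulV (R : unitRingType) (f : fps R) : f 0%N \is a GRing.unit ->
  fps_mul f (fps_inv f) =1 fps_of_poly 1.
Proof.
move=> f0 n; rewrite /fps_mul /fps_of_poly coef1 (reindex_inj rev_ord_inj) /=.
rewrite big_ord_recr /= subSS subnn subn0 [fps_inv f n]fps_invE mulVKr //.
rewrite [X in X + _](_ : _ = \sum_(i < n) f (n - i)%N * fps_inv f i).
  by rewrite addrC subrK.
by apply: eq_bigr => i _; rewrite subSS subKn // ltnW.
Qed.

Definition ehrhart_series (R : realType) (d j : nat) : fps R :=
  fun n => (@lattice_count R d j n)%:R.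

(* Positions and values of s : 'S_m are numbered from 0. *)
Definition des (m : nat) (s : 'S_m) : nat :=
  #|[set i : 'I_m | [exists k : 'I_m, (k == i.+1 :> nat) && (s k < s i)%N]]%SET|.

(* [(s i).+1] at the last position [i] is the value written $\sigma_m$. *)
Definition restricted_eulerian (R : nzRingType) (j m : nat) : {poly R} :=
  \sum_(s : 'S_m | [exists i : 'I_m, (i.+1 == m) && ((s i).+1 == m + 1 - j)%N])
    'X^(des s).

Definition real_rooted (R : realType) (p : {poly R}) : Prop :=
  forall z : R[i], root (map_poly (real_complex R) p) z -> complex.Im z = 0.

Definition unimodal (R : realType) (a : seq R) : Prop :=
  exists k : nat,
    (forall i, (i < k)%N -> (i.+1 < size a)%N -> a`_i <= a`_i.+1) /\
    (forall i, (k <= i)%N -> (i.+1 < size a)%N -> a`_i.+1 <= a`_i).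

(* Main.v *)
Require Import Defs.
From HB Require Import structures.
From mathcomp Require Import all_boot all_order all_algebra all_fingroup finmap.
From mathcomp Require Import complex.
From mathcomp Require Import boolp classical_sets functions cardinality reals.
From mathcomp Require Import ring lra zify.

Set Implicit Arguments.
Unset Strict Implicit.
Unset Printing Implicit Defensive.

Import Order.TTheory GRing.Theory Num.Theory.
Local Open Scope ring_scope.

(* Let E(d,v) be the descent polynomial of the permutations of {0..d} whose last
   value is v.  Deleting the last value gives
     E(d+1,v) = sum_(u < v) E(d,u) + t sum_(u >= v) E(d,u),
   and telescoping (n+1)^v n^(d+1-v) - n^v (n-1)^(d+1-v) shows that
   (1-t)^(d+1) sum_n (n+1)^v n^(d-v) t^n obeys the same recursion, while
   (n+1)^(d-j) n^j is the number of lattice points of the n-th dilate.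

   The recursion also yields E(d+1,v) = t ((1-t) E' + (d+1) E) with E = E(d,v), a
   polar derivative at 1, and E(d,0) = t E(d,d).  If E has only real roots r <= 0,
   then off the real axis the polar derivative is E times
   (d+1 - deg E) + sum_r (1-r)/(z-r), whose imaginary part does not vanish (unless
   E is constant).  So every E(d,v) is real-rooted.  Unimodality follows since a
   product of factors t + a with a >= 0 is log-concave without internal zeros. *)

(** * Descents and the recursion on the last value *)

Lemma desE m (s : 'S_m.+1) :
  des s = (\sum_(i < m) (s (lift ord0 i) < s (lift ord_max i)))%N.
Proof.
rewrite /des -sum1_card big_mkcond big_ord_recr /= addnC ifN; last first.
  rewrite inE; apply/existsP => -[k /andP[/eqP k_eq _]].
  by have := ltn_ord k; rewrite k_eq ltnn.
rewrite add0n; apply: eq_bigr => i _.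
have -> : widen_ord (leqnSn m) i = lift ord_max i.
  by apply: val_inj; rewrite /= /bump leqNgt ltn_ord.
suff -> : (lift ord_max i \in [set i0 : 'I_m.+1 | [exists k : 'I_m.+1,
    (k == i0.+1 :> nat) && (s k < s i0)%N]]%SET)
    = (s (lift ord0 i) < s (lift ord_max i))%N by case: ifP.
rewrite inE; apply/existsP/idP => [[k /andP[/eqP k_eq lt_s]]|lt_s].
  suff <- : k = lift ord0 i by [].
  by apply: val_inj; rewrite /= k_eq /= /bump; have := ltn_ord i; lia.
by exists (lift ord0 i); rewrite lt_s andbT /= /bump; have := ltn_ord i; lia.
Qed.

(** Only the summand u = v changes. The Eulerian and the lattice-point recursions both pass from v
    to v+1 this way. *)
Lemma sum_threshold_step (V : zmodType) m (a b : nat -> V) v : (v < m)%N ->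
  \sum_(u < m) (if (v <= u)%N then b u else a u) + (a v - b v) =
  \sum_(u < m) (if (v.+1 <= u)%N then b u else a u).
Proof.
move=> lt_vm; rewrite (bigD1 (Ordinal lt_vm)) //= [RHS](bigD1 (Ordinal lt_vm)) //=.
rewrite leqnn ltnn addrAC addrCA subrr addr0; congr (_ + _); apply: eq_bigr => u.
by rewrite -val_eqE /= => neq_uv; rewrite [(v <= u)%N]leq_eqVlt eq_sym (negPf neq_uv).
Qed.

Section RestrictedEulerian.
Variable R : nzRingType.

(* The paper's $A_{j+1}(d+1,t)$ is [eulerian_last d (d - j)]. *)
Definition eulerian_last d v : {poly R} :=
  \sum_(s : 'S_d.+1 | s ord_max == v :> nat) 'X^(des s).

Lemma restricted_eulerianE d j : (j <= d)%N ->
  restricted_eulerian R j.+1 d.+1 = eulerian_last d (d - j).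
Proof.
move=> le_jd; apply: eq_bigl => s; apply/existsP/eqP.
  case=> i /andP[/eqP[i_eq] /eqP s_eq].
  have -> : ord_max = i by apply: val_inj.
  by lia.
by move=> s_eq; exists ord_max; rewrite eqxx s_eq /=; apply/eqP; lia.
Qed.

Lemma eulerian_last00 : eulerian_last 0 0 = 1.
Proof.
rewrite /eulerian_last (big_pred1 1%g) => [|s /=]; last first.
  by rewrite (ord1 (s ord_max)); apply/esym/eqP/permP => i; rewrite !ord1.
by rewrite desE big_ord0.
Qed.

(** Inserting a last value keeps the relative order of the others, so only the final pair can add a
    descent. The old last value u becomes u+1 if v <= u and stays u otherwise, so it exceeds v
    exactly when v <= u. *)
Lemma des_lift_perm_max d (v : 'I_d.+2) (s : 'S_d.+1) :
  des (lift_perm ord_max v s) = ((v <= s ord_max) + des s)%N.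
Proof.
rewrite !desE big_ord_recr /= addnC; congr (_ + _)%N.
  rewrite lift_perm_lift.
  have -> : lift ord0 ord_max = ord_max :> 'I_d.+2 by apply: val_inj.
  rewrite lift_perm_id /= /bump; case: leqP => /= h; lia.
apply: eq_bigr => i _.
have -> : lift ord0 (widen_ord (leqnSn d) i) = lift ord_max (lift ord0 i) :> 'I_d.+2.
  apply: val_inj; rewrite /= /bump /=; have := ltn_ord i; lia.
have -> : widen_ord (leqnSn d) i = lift ord_max i.
  by apply: val_inj; rewrite /= /bump leqNgt ltn_ord.
rewrite !lift_perm_lift /= /bump; lia.
Qed.

Lemma eulerian_last_rec d v : (v <= d.+1)%N ->
  eulerian_last d.+1 v = \sum_(u < d.+1) 'X^(v <= u) * eulerian_last d u.
Proof.
move=> le_vd; pose w : 'I_d.+2 := Ordinal (le_vd : (v < d.+2)%N).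
rewrite /eulerian_last (reindex (lift_perm ord_max w)); last first.
  (* The inverse deletes position [i] and value [s i]; injectivity of [s] keeps the default [k] from
     being reached. *)
  pose f i (s : 'S_d.+2) k := odflt k (unlift (s i) (s (lift i k))).
  have fK i (s : 'S_d.+2) k : lift (s i) (f i s k) = s (lift i k).
    rewrite /f; have := neq_lift i k.
    by rewrite -(can_eq (permK s)) => /unlift_some[] ? ? ->.
  have f_inj s : injective (f ord_max s).
    move=> k k' /(congr1 (lift (s ord_max))); rewrite !fK => /perm_inj.
    exact: lift_inj.
  exists (fun s => perm (f_inj s)) => [s _|s].
    by apply/permP=> k; rewrite permE /f lift_perm_lift lift_perm_id liftK.
  rewrite inE => /eqP s_max; have {}s_max : s ord_max = w by apply: val_inj.
  apply/permP=> k; case: (unliftP ord_max k) => [k'|] ->.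
    by rewrite lift_perm_lift -s_max permE fK.
  by rewrite lift_perm_id.
rewrite (eq_bigl xpredT) => [|s]; last by rewrite lift_perm_id eqxx.
rewrite (partition_big (fun s : 'S_d.+1 => s ord_max) xpredT) //=.
apply: eq_bigr => u _; rewrite big_distrr /=; apply: eq_big => [s|s /eqP su].
  by rewrite -val_eqE.
by rewrite des_lift_perm_max su exprD.
Qed.

Lemma eulerian_last_step d v : (v <= d)%N ->
  eulerian_last d.+1 v.+1 = eulerian_last d.+1 v + (1 - 'X) * eulerian_last d v.
Proof.
move=> le_vd; rewrite !eulerian_last_rec ?(leqW le_vd) //.
have E w : \sum_(u < d.+1) 'X^(w <= u) * eulerian_last d u = \sum_(u < d.+1)
    (if (w <= u)%N then 'X * eulerian_last d u else eulerian_last d u).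
  by apply: eq_bigr => u _; case: leqP; rewrite ?expr1 ?expr0 ?mul1r.
rewrite !E mulrBl mul1r.
by rewrite (@sum_threshold_step _ _ (eulerian_last d) (fun u => 'X * eulerian_last d u)).
Qed.

(** In the recursion every summand carries a factor t for v = 0, and none does for v = d+1. *)
Lemma eulerian_last0 d : eulerian_last d.+1 0 = 'X * eulerian_last d.+1 d.+1.
Proof.
rewrite !eulerian_last_rec // big_distrr /=; apply: eq_bigr => u _.
by rewrite leqNgt ltn_ord /= mul1r.
Qed.

Lemma size_eulerian_last d v : (size (eulerian_last d v) <= d.+1)%N.
Proof.
apply: (leq_trans (size_sum _ _ _)); apply/bigmax_leqP => s _.
rewrite size_polyXn ltnS desE -[leqRHS](card_ord d) -sum1_card.
by apply: leq_sum => i _; case: (_ < _)%N.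
Qed.

End RestrictedEulerian.

Lemma eulerian_last_ge0 (R : numDomainType) d v i : 0 <= (eulerian_last R d v)`_i.
Proof.
by rewrite coef_sum; apply: sumr_ge0 => s _; rewrite coefXn ler0n.
Qed.

(** * Counting lattice points in the dilates *)

Local Open Scope classical_set_scope.

Lemma lattice_countE (R : realType) (d j n : nat) : (j <= d)%N ->
  @lattice_count R d j n = (n.+1 ^ (d - j) * n ^ j)%N.
Proof.
move=> le_jd.
pose g (f : {ffun 'I_d -> 'I_n.+1}) : 'rV[R]_d := \row_i (f i)%:R.
have g_inj : injective g.
  move=> f f' /rowP gff'; apply/ffunP => i; apply: val_inj.
  by have := gff' i; rewrite !mxE => /eqP; rewrite eqr_nat => /eqP.
(* The coordinates are independent: counted from 0, those with i >= d - j avoid n and the others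
   take all n+1 values. *)
pose F (i : 'I_d) : pred 'I_n.+1 := fun k => (d - j <= i)%N ==> (k != n :> nat).
have pts_eq : @lattice_points R d j n = g @` [set` (family F)].
  apply/seteqP; split=> [x [[xcube xfacet] xint]|_ [f /familyP fF <-]].
    have xnat i : x 0 i \is a Num.nat.
      by rewrite natrEint xint; have /andP[] := xcube i.
    have truncn_lt i : (Num.truncn (x 0%R i) < n.+1)%N.
      by rewrite ltnS -(ler_nat R) truncnK //; have /andP[] := xcube i.
    exists [ffun i => inord (Num.truncn (x 0 i))]; last first.
      by apply/rowP => i; rewrite mxE ffunE inordK // truncnK.
    apply/familyP => i; rewrite ffunE; apply/implyP => le_i.
    rewrite inordK //; apply/eqP => eq_n; apply: xfacet; exists i.
    by split; [lia|rewrite -(truncnK (xnat i)) eq_n].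
  split; [split|] => [i|[i [le_i]]|i]; rewrite mxE.
  - by rewrite ler0n ler_nat -ltnS ltn_ord.
  - move=> /eqP; rewrite eqr_nat => /eqP fi_n; have := fF i.
    by rewrite /in_mem /= /F fi_n eqxx implybF -ltnNge => ?; lia.
  - by rewrite natr_int.
rewrite /lattice_count pts_eq fset_set_image; last exact: finite_finset.
rewrite card_imfset //=.
have -> : #|` fset_set [set` (family F)]| = #|family F|.
  rewrite cardE; apply: perm_size; apply: uniq_perm; rewrite ?enum_uniq //.
  by move=> f; rewrite in_fset_set ?mem_enum; [apply/idP/idP; rewrite inE|exact: finite_finset].
rewrite card_family foldrE big_map big_enum /=.
rewrite (eq_bigr (fun i : 'I_d => if (i < d - j)%N then n.+1 else n)); last first.
  move=> i _; case: ltnP => le_i.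
    by rewrite -[RHS]card_ord; apply: eq_card => k; rewrite /in_mem /= /F leqNgt le_i.
  rewrite (@eq_card _ _ (predC1 ord_max)) => [|k]; last by rewrite /in_mem /= /F le_i.
  by have := cardC1 (@ord_max n); rewrite card_ord.
rewrite -(big_mkord xpredT (fun i => if (i < d - j)%N then n.+1 else n)).
rewrite (big_cat_nat _ (leq_subr j d)) //=.
rewrite (eq_big_nat _ _ (F2 := fun=> n.+1)) => [|i /andP[_ ->]//].
rewrite [X in (_ * X)%N](eq_big_nat _ _ (F2 := fun=> n)); last first.
  by move=> i /andP[le_i _]; rewrite ltnNge le_i.
by rewrite !prod_nat_const_nat subn0 subKn.
Qed.

Local Close Scope classical_set_scope.

(** * Truncated generating polynomials of the counts *)

Section CubeSeries.
Variable R : comNzRingType.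

Definition cube_poly N d v : {poly R} :=
  \poly_(n < N) ((n.+1 ^ v * n ^ (d - v))%N%:R).

(** Congruence modulo t^N, which lets power series be handled in the polynomial ring. *)
Definition eq_coef_below N (p q : {poly R}) := forall n, (n < N)%N -> p`_n = q`_n.

Lemma eq_coef_belowM N p p' q q' :
  eq_coef_below N p q -> eq_coef_below N p' q' -> eq_coef_below N (p * p') (q * q').
Proof.
move=> pq pq' n lt_nN; rewrite !coefM; apply: eq_bigr => i _.
have := ltn_ord i; rewrite ltnS => le_in.
by rewrite pq ?pq' //; [exact: leq_ltn_trans (leq_subr _ _) lt_nN|exact: leq_ltn_trans lt_nN].
Qed.

Lemma cube_poly_step N d v : (v <= d)%N ->
  cube_poly N d.+1 v.+1 = cube_poly N d.+1 v + cube_poly N d v.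
Proof.
move=> le_vd; apply/polyP => n; rewrite coefD !coef_poly.
case: ltnP => _; last by rewrite addr0.
rewrite -natrD subSS subSn // !expnS; congr _%:R; ring.
Qed.

Lemma cube_poly_rec N d v : (v <= d.+1)%N ->
  eq_coef_below N ((1 - 'X) * cube_poly N d.+1 v)
    (\sum_(u < d.+1) 'X^(v <= u) * cube_poly N d u).
Proof.
elim: v => [|v IHv] le_vd n lt_nN.
  rewrite (eq_bigr (fun u : 'I_d.+1 => 'X * cube_poly N d u)) // -big_distrr /=.
  rewrite mulrBl mul1r coefB !coefXM; case: n lt_nN => [|n] lt_nN /=.
    by rewrite coef_poly lt_nN expn0 mul1n exp0n // subr0.
  rewrite coef_sum !coef_poly lt_nN ltnW // !expn0 !mul1n !subn0.
  (* The difference (n+1)^(d+1) - n^(d+1) factors, and its first factor is 1. *)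
  transitivity ((n.+1%:R - n%:R) * \sum_(i < d.+1) n.+1%:R ^+ (d.+1.-1 - i) * n%:R ^+ i : R).
    by rewrite -subrXX !natrX.
  have -> : n.+1%:R - n%:R = 1 :> R by rewrite -natr1 addrAC subrr add0r.
  rewrite mul1r (reindex_inj rev_ord_inj) /=.
  apply: eq_bigr => i _; rewrite coef_poly ltnW // natrM !natrX.
  by have := ltn_ord i => lt_i; congr (_ ^+ _ * _ ^+ _); lia.
rewrite cube_poly_step // mulrDr coefD IHv ?(ltnW le_vd) //.
have E w : \sum_(u < d.+1) 'X^(w <= u) * cube_poly N d u = \sum_(u < d.+1)
    (if (w <= u)%N then 'X * cube_poly N d u else cube_poly N d u).
  by apply: eq_bigr => u _; case: leqP; rewrite ?expr1 ?expr0 ?mul1r.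
rewrite -coefD !E mulrBl mul1r.
by rewrite (@sum_threshold_step _ _ (cube_poly N d) (fun u => 'X * cube_poly N d u)).
Qed.

Lemma cube_poly_eulerian N d v : (v <= d)%N ->
  eq_coef_below N ((1 - 'X) ^+ d.+1 * cube_poly N d v) (eulerian_last R d v).
Proof.
elim: d v => [|d IHd] v le_vd n lt_nN.
  move: le_vd; rewrite leqn0 => /eqP->.
  rewrite eulerian_last00 expr1 mulrBl mul1r coefB coefXM !coef_poly coef1 lt_nN.
  by case: n lt_nN => [|n] lt_nN; rewrite ?subr0 // ltnW // subrr.
(* One factor 1 - t is spent on [cube_poly_rec]; the remaining d+1 serve the induction hypothesis in
   each summand. *)
rewrite exprSr -mulrA (@eq_coef_belowM N _ _ ((1 - 'X) ^+ d.+1)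
  (\sum_(u < d.+1) 'X^(v <= u) * cube_poly N d u)) //; last exact: cube_poly_rec.
rewrite eulerian_last_rec // big_distrr /= !coef_sum; apply: eq_bigr => u _.
rewrite mulrCA; apply: (@eq_coef_belowM N) => //; apply: IHd; by rewrite -ltnS.
Qed.

End CubeSeries.

(** * From truncations to formal power series *)

Lemma fps_mul_truncE (R : comNzRingType) N (f g : fps R) n : (n < N)%N ->
  fps_mul f g n = (\poly_(i < N) f i * \poly_(i < N) g i)`_n.
Proof.
move=> lt_nN; rewrite coefM; apply: eq_bigr => i _; rewrite !coef_poly.
have := ltn_ord i; rewrite ltnS => le_in.
by rewrite (leq_ltn_trans le_in) // (leq_ltn_trans (leq_subr _ _)).
Qed.

Lemma ehrhart_series_eulerian (R : realType) d j : (j <= d)%N ->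
  @ehrhart_series R d j = fps_div (fps_of_poly (eulerian_last R d (d - j)))
    (fps_of_poly ((1 - 'X) ^+ d.+1)).
Proof.
move=> le_jd; apply: funext => n; set Q := (1 - 'X) ^+ d.+1.
(* Coefficient n only depends on the factors modulo t^(n+1), where the numerator is the count series
   times [Q] and [Q] cancels its inverse. *)
pose N := n.+1; have lt_nN : (n < N)%N by [].
have trunc_poly (p : {poly R}) : eq_coef_below N (\poly_(i < N) fps_of_poly p i) p.
  by move=> i lt_iN; rewrite coef_poly lt_iN.
have QV : eq_coef_below N (\poly_(i < N) fps_of_poly Q i *
    \poly_(i < N) fps_inv (fps_of_poly Q) i) 1.
  move=> i lt_iN; rewrite -fps_mul_truncE // fps_mulV //.
  by rewrite /fps_of_poly -horner_coef0 !hornerE subr0 expr1n unitr1.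
have EQ : eq_coef_below N (\poly_(i < N) fps_of_poly (eulerian_last R d (d - j)) i)
    (cube_poly R N d (d - j) * \poly_(i < N) fps_of_poly Q i).
  move=> i lt_iN; rewrite trunc_poly // -(@cube_poly_eulerian _ N) ?leq_subr // mulrC.
  by apply: (@eq_coef_belowM _ N) => // k lt_kN; rewrite trunc_poly.
rewrite /fps_div (@fps_mul_truncE _ N) // (@eq_coef_belowM _ N _ _ _ _ EQ (fun _ _ => erefl)) //.
rewrite -mulrA (@eq_coef_belowM _ N _ _ _ _ (fun _ _ => erefl) QV) // mulr1.
by rewrite coef_poly lt_nN /ehrhart_series lattice_countE // subKn.
Qed.

(** * Real-rootedness and polar derivatives *)

Lemma real_rooted_neq0 (R : realType) (p : {poly R}) : real_rooted p -> p != 0.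
Proof.
(* The zero polynomial would have the non-real root i. *)
move=> p_real; apply/eqP => p0; have := p_real (0 +i* 1)%C.
by rewrite p0 rmorph0 root0 /= => /(_ isT)/eqP; rewrite oner_eq0.
Qed.

Lemma real_rooted_split (R : realType) (p : {poly R}) : real_rooted p ->
  exists rs : seq R, p = lead_coef p *: \prod_(r <- rs) ('X - r%:P).
Proof.
move=> p_real; have p_neq0 := real_rooted_neq0 p_real.
have [zs zs_eq] := closed_field_poly_normal (map_poly (real_complex R) p).
exists [seq complex.Re z | z <- zs]; apply: (map_poly_inj (real_complex R)).
rewrite [LHS]zs_eq lead_coef_map map_polyZ; congr (_ *: _).
rewrite big_map rmorph_prod /= [LHS]big_seq [RHS]big_seq; apply: eq_bigr => z z_in.
rewrite rmorphB /= map_polyX map_polyC /=; congr (_ - _%:P).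
have : root (map_poly (real_complex R) p) z.
  by rewrite zs_eq rootZ ?root_prod_XsubC // lead_coef_map fmorph_eq0 lead_coef_eq0.
by move=> /p_real; case: z {z_in} => x y /= ->.
Qed.

(** At r > 0 the leading term is positive and no other term is negative. *)
Lemma nneg_poly_root_le0 (R : realType) (p : {poly R}) r :
  (forall i, 0 <= p`_i) -> p != 0 -> root p r -> r <= 0.
Proof.
move=> p_ge0 p_neq0 /rootP pr0; rewrite leNgt; apply/negP => r_gt0.
have : 0 < p.[r]; last by rewrite pr0 ltxx.
rewrite horner_coef; have : (0 < size p)%N by rewrite size_poly_gt0.
case E: (size p) => [//|n] _; rewrite big_ord_recr /=.
apply: ltr_wpDl; first by apply: sumr_ge0 => i _; rewrite mulr_ge0 // exprn_ge0 // ltW.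
rewrite mulr_gt0 ?exprn_gt0 // lt_def p_ge0 andbT.
by have := p_neq0; rewrite -lead_coef_eq0 lead_coefE E.
Qed.

Lemma real_rooted_nneg_split (R : realType) (p : {poly R}) :
  real_rooted p -> (forall i, 0 <= p`_i) ->
  exists c (rs : seq R), [/\ p = c *: \prod_(r <- rs) ('X - r%:P), 0 < c &
    {in rs, forall r, r <= 0}].
Proof.
move=> p_real p_ge0; have [rs p_eq] := real_rooted_split p_real.
have p_neq0 := real_rooted_neq0 p_real.
exists (lead_coef p), rs; split=> //.
  by rewrite lt_def lead_coef_eq0 p_neq0 lead_coefE p_ge0.
move=> r r_in; apply: (nneg_poly_root_le0 p_ge0 p_neq0).
by rewrite p_eq rootZ ?root_prod_XsubC // lead_coef_eq0.
Qed.

Lemma horner_deriv_prod_XsubC (F : fieldType) (rs : seq F) z :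
  z \notin rs -> (\prod_(r <- rs) ('X - r%:P))^`().[z] =
    (\prod_(r <- rs) ('X - r%:P)).[z] * \sum_(r <- rs) (z - r)^-1.
Proof.
elim: rs => [|r rs IHrs]; first by rewrite !big_nil derivC !hornerE.
rewrite inE negb_or -subr_eq0 => /andP[zr /IHrs IH].
rewrite !big_cons derivM derivXsubC !hornerE IH; field; exact: zr.
Qed.

(** Termwise, (1-z)/(z-r) = (1-r)/(z-r) - 1. *)
Lemma polar_sumE (F : fieldType) (rs : seq F) z : z \notin rs ->
  (1 - z) * \sum_(r <- rs) (z - r)^-1 =
  \sum_(r <- rs) (1 - r) / (z - r) - (size rs)%:R.
Proof.
elim: rs => [|r rs IHrs]; first by rewrite !big_nil mulr0 subrr.
rewrite inE negb_or -subr_eq0 => /andP[zr /IHrs IH].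
by rewrite !big_cons mulrDr IH /= -[(size rs).+1%:R]natr1; field.
Qed.

(** Im (1/(z-r)) = - Im z / |z-r|^2; the factor Im z treats both half-planes at once. *)
Lemma Im_div_lt0 (R : realType) (r : R) (z : R[i]) : r < 1 -> complex.Im z != 0 ->
  complex.Im z * complex.Im ((1 - r%:C%C) / (z - r%:C%C)) < 0.
Proof.
case: z => x y /= r_lt1 y_neq0.
have D : 0 < (x - r) ^+ 2 + y ^+ 2.
  by apply: ltr_wpDl; rewrite ?sqr_ge0 // exprn_even_gt0.
rewrite subr0 subrr mul0r addr0 mulrN mulrN oppr_lt0 mulrCA mulr_gt0 ?subr_gt0 //.
by rewrite mulrA -expr2 divr_gt0 // exprn_even_gt0.
Qed.


(* For [z] off the real axis, [horner_deriv_prod_XsubC] and [polar_sumE] turn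
   the value at [z] into [p.[z]] times a positive real plus the sum of the
   [(1 - r) / (z - r)], whose imaginary parts all have the sign of [- Im z]. *)
Lemma real_rooted_polar (R : realType) (p : {poly R}) n :
  real_rooted p -> (forall i, 0 <= p`_i) -> (size p <= n)%N ->
  real_rooted ((1 - 'X) * p^`() + n%:R *: p).
Proof.
move=> p_real p_ge0; have [c [rs [-> c_gt0 rs_le0]]] := real_rooted_nneg_split p_real p_ge0.
rewrite size_scale ?gt_eqF // size_prod_XsubC => lt_n z.
set q := \prod_(r <- rs) _; pose rsC := [seq real_complex R r | r <- rs].
have -> : map_poly (real_complex R) ((1 - 'X) * (c *: q)^`() + n%:R *: (c *: q)) =
  (c%:C)%C *: ((1 - 'X) * (\prod_(r <- rsC) ('X - r%:P))^`()
     + n%:R *: \prod_(r <- rsC) ('X - r%:P)).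
  have -> : \prod_(r <- rsC) ('X - r%:P) = map_poly (real_complex R) q.
    rewrite big_map rmorph_prod; apply: eq_bigr => r _.
    by rewrite /= rmorphB /= map_polyX map_polyC.
  rewrite derivZ rmorphD rmorphM rmorphB /= !map_polyZ /= deriv_map map_polyX rmorph1 rmorph_nat.
  by rewrite -scalerAr scalerDr; congr (_ + _); rewrite !scalerA mulrC.
rewrite rootZ; last by rewrite fmorph_eq0 gt_eqF.
have [//|z_im] := eqVneq (complex.Im z) 0.
have z_notin : z \notin rsC.
  by apply/mapP => -[r _ z_eq]; rewrite z_eq eqxx in z_im.
have := horner_deriv_prod_XsubC z_notin; have := root_prod_XsubC rsC z.
rewrite (negPf z_notin); move: (\prod_(r <- rsC) _) => P /negbT Pz_neq0 P'z.
move=> /rootP; rewrite !hornerE P'z mulrCA polar_sumE // [n%:R * _]mulrC -mulrDr.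
move=> /eqP; rewrite mulf_eq0 (negPf (Pz_neq0 : P.[z] != 0)) /=.
rewrite /rsC size_map big_map -addrA addr_eq0.
(* Without roots the remaining factor is n, nonzero by the size bound; otherwise its vanishing would
   make the sum real. *)
case: rs rs_le0 lt_n {q rsC z_notin P'z} => [_ lt_n|r rs rs_le0 _].
  by rewrite big_nil eq_sym oppr_eq0 oppr0 add0r pnatr_eq0; case: n lt_n.
move=> /eqP sum_eq.
suff : complex.Im z * complex.Im (\sum_(r' <- r :: rs)
    (1 - r'%:C%C) / (z - r'%:C%C)) < 0.
  by rewrite sum_eq -!(rmorph_nat (real_complex R)) -rmorphN -rmorphD -rmorphN /= mulr0 ltxx.
rewrite raddf_sum big_distrr /= big_seq big_cons mem_head.
have lt0 r' : r' \in r :: rs -> complex.Im z * complex.Im ((1 - r'%:C%C) / (z - r'%:C%C)) < 0.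
  by move=> /rs_le0 r'_le0; apply: Im_div_lt0 => //; exact: le_lt_trans ltr01.
apply: ltr_wnDr; last exact/lt0/mem_head.
by apply: sumr_le0 => r' /lt0/ltW.
Qed.

(** * Log-concavity and unimodality *)

Lemma mul_XaddC_coefS (R : comNzRingType) (p : {poly R}) a i :
  (('X + a%:P) * p)`_i.+1 = p`_i + a * p`_i.+1.
Proof. by rewrite mulrDl coefD coefXM coefCM. Qed.

Lemma mul_XaddC_coef0 (R : comNzRingType) (p : {poly R}) a :
  (('X + a%:P) * p)`_0 = a * p`_0.
Proof. by rewrite mulrDl coefD coefXM coefCM add0r. Qed.

(* For a nonnegative sequence: log-concavity without internal zeros. *)
Definition strongly_log_concave (R : numDomainType) (a : nat -> R) :=
  forall i j, (i <= j)%N -> a i * a j.+2 <= a i.+1 * a j.+1.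

Lemma strongly_log_concave_mul (R : realDomainType) (p : {poly R}) a :
  0 <= a -> (forall i, 0 <= p`_i) -> strongly_log_concave (nth 0 p) ->
  strongly_log_concave (nth 0 (('X + a%:P) * p)).
Proof.
move=> a_ge0 p_ge0 p_lc i j le_ij; case: i le_ij => [|i] le_ij.
  rewrite mul_XaddC_coef0 !mul_XaddC_coefS.
  have h1 := p_lc 0 j le_ij.
  have h2 : 0 <= p`_0 * p`_j by rewrite mulr_ge0.
  have h3 : 0 <= p`_1 * p`_j by rewrite mulr_ge0.
  nra.
case: j le_ij => // j le_ij; rewrite !mul_XaddC_coefS.
have h1 := p_lc i j le_ij; have h2 := p_lc i.+1 j.+1 le_ij.
(* Comparing powers of a, [h1] handles a^0, [h2] handles a^2, and this handles the cross terms. *)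
have h3 : p`_i * p`_j.+3 <= p`_i.+2 * p`_j.+1.
  have h4 := p_lc i j.+1 (leqW le_ij).
  move: le_ij; rewrite ltnS leq_eqVlt => /predU1P[ij|lt_ij].
    by move: h4; rewrite ij [leRHS]mulrC.
  exact/(le_trans h4)/p_lc.
nra.
Qed.

Lemma strongly_log_concave_unimodal (R : realType) (p : {poly R}) :
  (forall i, 0 <= p`_i) -> strongly_log_concave (nth 0 p) -> unimodal p.
Proof.
move=> p_ge0 p_lc.
have [ex|nex] := pselect (exists i, p`_i.+1 < p`_i); last first.
  exists (size p); split=> i; last by move=> /leqW; rewrite ltnNge => ->.
  by move=> _ _; rewrite leNgt; apply/negP => lt; apply: nex; exists i.
(* The peak k is the first strict descent. Beyond it, p_k p_(i+2) <= p_(k+1) p_(i+1) <= p_k p_(i+1),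
   and p_k > 0 cancels. *)
case: (ex_minnP ex) => k lt_k k_min; exists k; split=> i.
  by move=> lt_ik _; rewrite leNgt; apply/negP => /k_min; rewrite leqNgt lt_ik.
rewrite leq_eqVlt => /predU1P[<- _|]; first exact: ltW.
case: i => // i le_ki _.
have pk_gt0 : 0 < p`_k := le_lt_trans (p_ge0 _) lt_k.
rewrite -(ler_pM2l pk_gt0); apply: (le_trans (p_lc k i le_ki)).
by rewrite ler_wpM2r // ltW.
Qed.

Lemma real_rooted_unimodal (R : realType) (p : {poly R}) :
  real_rooted p -> (forall i, 0 <= p`_i) -> unimodal p.
Proof.
move=> p_real p_ge0; have [c [rs [p_eq c_gt0 rs_le0]]] := real_rooted_nneg_split p_real p_ge0.
apply: strongly_log_concave_unimodal => //; rewrite {}p_eq.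
suff [q_ge0 q_lc] : (forall i, 0 <= (\prod_(r <- rs) ('X - r%:P))`_i) /\
    strongly_log_concave (nth 0 (\prod_(r <- rs) ('X - r%:P))).
  move=> i j le_ij; rewrite !coefZ mulrACA [leRHS]mulrACA.
  by rewrite ler_wpM2l ?q_lc // mulr_ge0 // ltW.
elim: rs rs_le0 => [|r rs IHrs] rs_le0.
  rewrite big_nil; split=> [i|i j _]; first by rewrite coef1 ler0n.
  by rewrite !coef1 /= mulr0 mul0r.
have [r' r'_in|q_ge0 q_lc] := IHrs; first by rewrite rs_le0 // inE r'_in orbT.
have r_le0 : 0 <= - r by rewrite oppr_ge0 rs_le0 // mem_head.
rewrite big_cons -polyCN; split; last exact: strongly_log_concave_mul.
case=> [|i]; first by rewrite mul_XaddC_coef0 mulr_ge0.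
by rewrite mul_XaddC_coefS addr_ge0 // mulr_ge0.
Qed.

(** * The differential recursion *)

Section PolarRecursion.
Variable R : idomainType.

Let polar d (p : {poly R}) := 'X * ((1 - 'X) * p^`() + d.+1%:R *: p).

Lemma one_subX_neq0 : 1 - 'X != 0 :> {poly R}.
Proof. by rewrite -opprB oppr_eq0 -polyC1 polyXsubC_eq0. Qed.

Let polarD d p q : polar d (p + q) = polar d p + polar d q.
Proof. by rewrite /polar derivD scalerDr; ring. Qed.

(** Both sides describe the same series, written over a denominator with one more factor 1 - t. *)
Let polar_one_subXM d p : polar d.+1 ((1 - 'X) * p) = (1 - 'X) * polar d p.
Proof.
rewrite /polar derivM derivB derivX -polyC1 derivC polyC1 -!mul_polyC !rmorph_nat.
by rewrite -[d.+2%:R]natr1; ring.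
Qed.

Let polarXM d p : polar d ('X * p) = 'X * polar d p + 'X * (1 - 'X) * p.
Proof. by rewrite /polar derivM derivX -!mul_polyC; ring. Qed.

(* Multiplying the n-th term of $\sum_n (n+1)^v n^{d-v} t^n$ by n is applying
   $t\,\frac{d}{dt}$; this is its effect on the numerator over $(1-t)^{d+1}$. *)
Lemma eulerian_last_polar d v : (v <= d)%N ->
  eulerian_last R d.+1 v =
  'X * ((1 - 'X) * (eulerian_last R d v)^`() + d.+1%:R *: eulerian_last R d v).
Proof.
rewrite -/(polar d _); elim: d v => [|d IHd] v le_vd.
  move: le_vd; rewrite leqn0 => /eqP ->.
  rewrite eulerian_last_rec // big_ord1 eulerian_last00 /polar /= -polyC1 derivC.
  by rewrite mulr0 add0r expr1 scale1r.
(* Both sides of the claim have equal increments in w, so w = 0 suffices. *)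
have up w : (w <= d.+1)%N -> polar d.+1 (eulerian_last R d.+1 w) =
    polar d.+1 (eulerian_last R d.+1 0) + (eulerian_last R d.+2 w - eulerian_last R d.+2 0).
  elim: w => [|w IHw] le_wd; first by rewrite subrr addr0.
  rewrite eulerian_last_step // polarD IHw 1?ltnW // polar_one_subXM -IHd //.
  by rewrite [eulerian_last R d.+2 w.+1]eulerian_last_step 1?ltnW //; ring.
suff base : polar d.+1 (eulerian_last R d.+1 0) = eulerian_last R d.+2 0.
  by rewrite up // base addrC subrK.
(* Going from w = 0 up to w = d+1 and back by [eulerian_last0] gives (1-t) x = (1-t) b, hence x =
   b. *)
apply: (mulfI one_subX_neq0).
have := up d.+1 (leqnn _); set x := polar _ (eulerian_last R d.+1 d.+1).
rewrite eulerian_last0 polarXM -/x [eulerian_last R d.+2 0]eulerian_last0.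
rewrite [eulerian_last R d.+2 d.+2]eulerian_last_step // => up_max.
set a := eulerian_last R d.+1 d.+1 in up_max *.
set b := eulerian_last R d.+2 d.+1 in up_max *.
have {}up_max : (1 - 'X) * x = (1 - 'X) * b.
  apply/eqP; rewrite -subr_eq0; apply/eqP; move/eqP: up_max; rewrite -subr_eq0 => /eqP <-.
  ring.
have -> : x = b by apply: (mulfI one_subX_neq0).
ring.
Qed.

End PolarRecursion.

(** * Real-rootedness of the restricted Eulerian polynomials *)

Lemma real_rootedM (R : realType) (p q : {poly R}) :
  real_rooted (p * q) <-> real_rooted p /\ real_rooted q.
Proof.
rewrite /real_rooted; split=> [pq|[pr qr] z].
  by split=> z rz; apply: pq; rewrite rmorphM rootM rz ?orbT.
by rewrite rmorphM rootM => /orP[/pr|/qr].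
Qed.

Lemma real_rootedX (R : realType) : real_rooted ('X : {poly R}).
Proof. by move=> z; rewrite map_polyX rootX => /eqP->. Qed.

Lemma real_rooted_eulerian_last (R : realType) d v : (v <= d)%N ->
  real_rooted (eulerian_last R d v).
Proof.
have step k w : (w <= k)%N -> real_rooted (eulerian_last R k w) ->
    real_rooted (eulerian_last R k.+1 w).
  move=> le_wk real_k; rewrite eulerian_last_polar //.
  apply/real_rootedM; split; first exact: real_rootedX.
  by apply: (real_rooted_polar _ _ (size_eulerian_last _ _ _)) => // i; exact: eulerian_last_ge0.
have real0 k : real_rooted (eulerian_last R k 0).
  elim: k => [|k]; last exact: step.
  by move=> z; rewrite eulerian_last00 rmorph1 (negPf (root1 _)).
(* The route to (d,v) is (0,0), then (v,0) by [step], then (v,v) as a divisor of E(v,0), then [step]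
   at fixed v. *)
move=> /subnK <-; elim: (d - v)%N => [|k IHk]; last by rewrite addSn; apply: step; rewrite ?leq_addl.
case: v => [|v]; first exact: real0.
by have := real0 v.+1; rewrite eulerian_last0 => /real_rootedM[].
Qed.

Theorem theorem4p2 (R : realType) (d j : nat) (hd : (1 <= d)%N) (hj : (j <= d)%N) :
  [/\ @ehrhart_series R d j =
        fps_div (fps_of_poly (restricted_eulerian R j.+1 d.+1))
                (fps_of_poly ((1 - 'X) ^+ d.+1)),
      real_rooted (restricted_eulerian R j.+1 d.+1) &
      unimodal (polyseq (restricted_eulerian R j.+1 d.+1))].
Proof.
have real_E := @real_rooted_eulerian_last R d (d - j) (leq_subr _ _).
rewrite restricted_eulerianE //; split=> //; first exact: ehrhart_series_eulerian.
by apply: real_rooted_unimodal => // i; exact: eulerian_last_ge0.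
Qed.
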